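(* Let $n\ge 1$ and $m\ge 1$ be integers and, for each integer $i\ge 0$, let ${\bf A}^{0}_i,\dots,{\bf A}^{n-1}_i$ be real $m\times m$ matrices. Consider a sequence $(\delta{\bf x}_i)_{i\ge 0}$ in $\mathbb{R}^m$ satisfying the virtual dynamics $$\delta {\bf x}_{i+n} = {\bf A}^{n-1}_i\,\delta {\bf x}_{i+n-1} + \cdots + {\bf A}^{0}_i\,\delta {\bf x}_i \qquad\text{for all } i\ge 0 .$$ Let $\lambda>0$ be a real constant such that $$\lambda^n \ \ge\ |{\bf A}^{n-1}_i|\,\lambda^{n-1} + \cdots + |{\bf A}^{1}_i|\,\lambda + |{\bf A}^{0}_i| \qquad\text{for all } i\ge 0,$$ and let $K>0$ be a real constant such that $$|\delta {\bf x}_j|\le K\lambda^{j}\qquad \text{for } 0\le j<n .$$ Then $$|\delta {\bf x}_{i+n}|\le K\lambda^{i+n}\qquad\text{for all } i\ge 0 .$$ Consequently, if $\lambda<1$, the system is contracting: every solution $(\delta{\bf x}_i)$ of the virtual dynamics converges to $0$ exponentially (at geometric rate $\lambda$).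
   Context: For vectors, $|\cdot|$ is the Euclidean norm on $\mathbb{R}^m$; for matrices, $|\cdot|$ is the largest singular value (the induced operator norm). The ''virtual dynamics'' is the linearization, along a trajectory, of an $n$-th order nonlinear time-varying discrete-time system ${\bf x}_{i+n}={\bf f}_i({\bf x}_{i+n-1},\dots,{\bf x}_i,i)$ with smooth ${\bf f}_i$; $\delta{\bf x}_i$ is the differential displacement at step $i$ between neighbouring trajectories and ${\bf A}^{k}_i=\partial {\bf f}_i/\partial {\bf x}_{i+k}$. ''Contracting'' means that virtual displacements converge to zero exponentially. *)

(* Defs.v *)
From HB Require Import structures.
From mathcomp Require Export all_boot all_order all_algebra.
From mathcomp Require Export all_classical all_reals all_analysis.

Set Implicit Arguments.
Unset Strict Implicit.
Unset Printing Implicit Defensive.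

Import Order.TTheory GRing.Theory Num.Theory.
Export numFieldNormedType.Exports.

Local Open Scope classical_set_scope.
Local Open Scope ring_scope.

(* MathComp-Analysis puts the max norm on matrices, hence a separate Euclidean
   norm. *)
Definition euclidean_norm (R : realType) (m : nat) (v : 'cV[R]_m) : R :=
  Num.sqrt (\sum_(j < m) v j 0 ^+ 2).

(* [eigenvalue] refers to row eigenvectors, which is immaterial here since
   [A^T *m A] is symmetric. *)
Definition singular_value (R : realType) (m : nat) (A : 'M[R]_m) (s : R) : Prop :=
  0 <= s /\ eigenvalue (A^T *m A) (s ^+ 2).

(* For [0 < m] the set of singular values is finite and nonempty, so that the
   supremum is a maximum. *)
Definition largest_singular_value (R : realType) (m : nat) (A : 'M[R]_m) : R :=
  sup [set s | singular_value A s].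

(* [A i k] is the Jacobian block multiplying the displacement at step [i + k]. *)
Definition virtual_dynamics (R : realType) (n m : nat)
    (A : nat -> 'I_n -> 'M[R]_m) (dx : nat -> 'cV[R]_m) : Prop :=
  forall i : nat, dx (i + n)%N = \sum_(k < n) A i k *m dx (i + k)%N.

Definition converges_to_0_at_rate (R : realType) (m : nat) (lambda : R)
    (dx : nat -> 'cV[R]_m) : Prop :=
  euclidean_norm (dx i) @[i --> \oo] --> (0 : R) /\
  exists2 C : R, 0 < C &
    forall i : nat, euclidean_norm (dx i) <= C * lambda ^+ i.

Definition contracting_at_rate (R : realType) (n m : nat) (lambda : R)
    (A : nat -> 'I_n -> 'M[R]_m) : Prop :=
  forall dx : nat -> 'cV[R]_m,
    virtual_dynamics A dx -> converges_to_0_at_rate lambda dx.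

(* Main.v *)
(** The supremum [c] of the Rayleigh quotient of [S = A^T *m A] is an eigenvalue
    of [S]: [B = c%:M - S] is positive semidefinite, and if it were invertible,
    Cauchy-Schwarz for the form of [B] applied to [B *m v] and [v] would give
    [e |v|^2 <= v^T B v] for some [e > 0], so that [c - e] would still bound the
    Rayleigh quotient.  Hence [Num.sqrt c] is the largest singular value of [A],
    and [|A v|^2 = v^T S v <= c |v|^2]. The exponential bound then follows by
    strong induction along the recurrence. *)

From mathcomp Require Import ring lra.
Require Import Defs.

Set Implicit Arguments.
Unset Strict Implicit.
Unset Printing Implicit Defensive.

Import Order.TTheory GRing.Theory Num.Theory.
Local Open Scope ring_scope.

Section Dot.
Variables (R : realType) (m : nat).
Implicit Types (u v w : 'cV[R]_m) (A B : 'M[R]_m).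

Definition dot u v : R := (u^T *m v) 0 0.

Lemma dotE u v : dot u v = \sum_(j < m) u j 0 * v j 0.
Proof. by rewrite /dot mxE; apply: eq_bigr => j _; rewrite mxE. Qed.

Lemma dotC u v : dot u v = dot v u.
Proof. by rewrite !dotE; apply: eq_bigr => j _; rewrite mulrC. Qed.

Lemma dotDr u v w : dot u (v + w) = dot u v + dot u w.
Proof. by rewrite /dot mulmxDr mxE. Qed.

Lemma dotDl u v w : dot (u + v) w = dot u w + dot v w.
Proof. by rewrite dotC dotDr !(dotC w). Qed.

Lemma dotZr u a v : dot u (a *: v) = a * dot u v.
Proof. by rewrite /dot -scalemxAr mxE. Qed.

Lemma dotZl u a v : dot (a *: u) v = a * dot u v.
Proof. by rewrite dotC dotZr dotC. Qed.

Lemma dot_trmx A u v : dot u (A *m v) = dot (A^T *m u) v.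
Proof. by rewrite /dot trmx_mul trmxK mulmxA. Qed.

Lemma dot_ge0 v : 0 <= dot v v.
Proof. by rewrite dotE sumr_ge0 // => j _; rewrite -expr2 sqr_ge0. Qed.

Lemma dot_gt0 v : v != 0 -> 0 < dot v v.
Proof.
move=> v0; rewrite lt0r dot_ge0 andbT; apply: contra v0 => /eqP.
rewrite dotE => /psumr_eq0P d0; apply/eqP/colP => j; rewrite mxE.
apply/eqP; rewrite -sqrf_eq0 expr2; apply/eqP/d0 => // i _.
by rewrite -expr2 sqr_ge0.
Qed.

(** The form of [B] at [u + t *: v] is a nonnegative quadratic polynomial in [t], so its
    discriminant is nonpositive. *)
Lemma psd_cauchy_schwarz B u v : B^T = B -> (forall w, 0 <= dot w (B *m w)) ->
  dot u (B *m v) ^+ 2 <= dot u (B *m u) * dot v (B *m v).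
Proof.
move=> symB psdB.
have q_ge0 t : 0 <= (\poly_(i < 3)
    [:: dot u (B *m u); 2 * dot u (B *m v); dot v (B *m v)]`_i).[t].
  rewrite horner_poly !big_ord_recl big_ord0 /=.
  have := psdB (u + t *: v).
  rewrite mulmxDr -scalemxAr !(dotDl, dotDr, dotZl, dotZr).
  rewrite (dot_trmx B v u) symB (dotC _ u) /bump /=.
  by congr (0 <= _); ring.
have := deg_le2_poly_ge0 (size_poly _ _) q_ge0.
by rewrite !coef_poly /=; lra.
Qed.

Lemma cauchy_schwarz u v : dot u v ^+ 2 <= dot u u * dot v v.
Proof.
have := @psd_cauchy_schwarz 1%:M u v; rewrite !mul1mx; apply; first exact: trmx1.
by move=> w; rewrite mul1mx dot_ge0.
Qed.

Lemma dot_mulmx_le A : exists2 C, 0 < C &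
  forall v, dot (A *m v) (A *m v) <= C * dot v v.
Proof.
(* The sum is the squared Frobenius norm, obtained by Cauchy-Schwarz on each row; adding 1 keeps the
   constant positive when [A] is zero. *)
exists (1 + \sum_i dot (row i A)^T (row i A)^T).
  by rewrite ltr_pwDl // sumr_ge0 // => i _; apply: dot_ge0.
move=> v; rewrite mulrDl mul1r (dotE (A *m v)) ler_wpDl ?dot_ge0 // mulr_suml.
apply: ler_sum => i _; apply: le_trans (cauchy_schwarz _ _).
suff -> : (A *m v) i 0 = dot (row i A)^T v by rewrite expr2.
by rewrite /dot trmxK -row_mul !mxE.
Qed.

(** Expanding [0 <= |v - A v|^2] bounds twice the form by [|v|^2 + |A v|^2]. *)
Lemma form_mulmx_le A : exists2 C, 0 < C &
  forall v, dot v (A *m v) <= C * dot v v.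
Proof.
have [C C0 CA] := dot_mulmx_le A; exists (1 + C); first by rewrite addr_gt0.
move=> v; have := CA v; have := dot_ge0 (v + -1 *: (A *m v)).
rewrite !(dotDl, dotDr, dotZl, dotZr) (dotC (A *m v) v).
have := dot_ge0 v; have := dot_ge0 (A *m v); nra.
Qed.

Lemma psd_unit_coercive B :
    B^T = B -> (forall w, 0 <= dot w (B *m w)) -> B \in unitmx ->
  exists2 e, 0 < e & forall v, e * dot v v <= dot v (B *m v).
Proof.
move=> symB psdB unitB.
have [M M0 leM] := form_mulmx_le B.
have [N N0 leN] := dot_mulmx_le (invmx B).
(* With [w = B v], the constant [N] gives [|v|^2 <= N |w|^2], while Cauchy-Schwarz for the form of
   [B] gives [|w|^4 <= (w^T B w) (v^T B v) <= M |w|^2 (v^T B v)]; then [|w|^2] cancels. *)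
exists (M * N)^-1; first by rewrite invr_gt0 mulr_gt0.
move=> v; rewrite ler_pdivrMl ?mulr_gt0 //.
have := leN (B *m v); rewrite mulKmx // => /le_trans; apply.
rewrite (mulrC M) -mulrA ler_pM2l //.
set w := B *m v; have [w0|/dot_gt0 w0] := eqVneq w 0.
  by rewrite w0 /dot !mulmx0 !mxE mulr0.
rewrite -(ler_pM2l w0); have := psd_cauchy_schwarz w v symB psdB.
rewrite -/w expr2 => /le_trans; apply.
by rewrite mulrA ler_wpM2r ?psdB // mulrC leM.
Qed.

Lemma euclidean_normE v : euclidean_norm v = Num.sqrt (dot v v).
Proof. by rewrite /euclidean_norm dotE. Qed.

Lemma euclidean_norm_ge0 v : 0 <= euclidean_norm v.
Proof. exact: sqrtr_ge0. Qed.

Lemma euclidean_norm_triangle u v :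
  euclidean_norm (u + v) <= euclidean_norm u + euclidean_norm v.
Proof.
rewrite -(@ler_pXn2r _ 2) // ?nnegrE ?addr_ge0 ?euclidean_norm_ge0 //.
rewrite !euclidean_normE sqrrD !sqr_sqrtr ?dot_ge0 //.
rewrite dotDl !dotDr (dotC v u) -sqrtrM ?dot_ge0 //.
have : dot u v <= Num.sqrt (dot u u * dot v v).
  by apply: le_trans (ler_norm _) _; rewrite -sqrtr_sqr ler_wsqrtr ?cauchy_schwarz.
by rewrite mulr2n; lra.
Qed.

Lemma euclidean_norm_sum (I : Type) (r : seq I) (F : I -> 'cV[R]_m) :
  euclidean_norm (\sum_(i <- r) F i) <= \sum_(i <- r) euclidean_norm (F i).
Proof.
elim/big_rec2: _ => [|i x v _ le_v].
  by rewrite euclidean_normE /dot mulmx0 mxE sqrtr0.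
by rewrite (le_trans (euclidean_norm_triangle _ _)) // lerD2l.
Qed.

(* [m = 0] is excluded: there the unit sphere is empty. *)
Lemma rayleigh_sup_eigenvalue A : (0 < m)%N -> A^T = A -> exists2 c,
  eigenvalue A c & forall v, dot v (A *m v) <= c * dot v v.
Proof.
move=> m0 symA; have [C C0 leC] := form_mulmx_le A.
pose E := [set x | exists2 v, dot v v = 1 & x = dot v (A *m v)]%classic.
have supE : has_sup E.
  split; last by exists C => x [v v1 ->]; rewrite (le_trans (leC v)) // v1 mulr1.
  exists (dot (delta_mx (Ordinal m0) 0) (A *m delta_mx (Ordinal m0) 0)).
  exists (delta_mx (Ordinal m0) 0) => //.
  by rewrite /dot trmx_delta mul_delta_mx !mxE !eqxx.
(* By homogeneity, a bound on the unit sphere extends to all vectors. *)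
have leE d : ubound E d -> forall v, dot v (A *m v) <= d * dot v v.
  move=> ubd v; have [->|v0] := eqVneq v 0.
    by rewrite /dot !mulmx0 mxE mulr0.
  have sv := dot_gt0 v0; set s := Num.sqrt (dot v v).
  have s0 : 0 < s by rewrite sqrtr_gt0.
  have ss : s * s = dot v v by rewrite -expr2 sqr_sqrtr ?ltW.
  rewrite -ler_pdivrMr //; apply: ubd; exists (s^-1 *: v).
    by rewrite dotZl dotZr -ss mulrA -invfM mulVf // mulf_neq0 ?gt_eqF.
  by rewrite -scalemxAr dotZl dotZr mulrA -invfM ss mulrC.
exists (sup E); last exact/leE/sup_upper_bound.
(* Being an eigenvalue amounts to singularity of [A - (sup E)%:M]; invertibility is refuted
   below. *)
rewrite /eigenvalue /eigenspace kermx_eq0 row_free_unit.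
apply/negP => unitA; pose B := (sup E)%:M - A.
have formB w : dot w (B *m w) = sup E * dot w w - dot w (A *m w).
  by rewrite mulmxBl mul_scalar_mx -scaleN1r dotDr !dotZr mulN1r.
have [|||e e0 leB] := @psd_unit_coercive B.
- by rewrite /B linearB /= tr_scalar_mx symA.
- by move=> w; rewrite formB subr_ge0; apply/leE/sup_upper_bound.
- by rewrite /B -opprB -scaleN1r unitmxZ ?unitrN1.
(* Coercivity of [B] makes [sup E - e] an upper bound of [E], below its supremum. *)
have : sup E <= sup E - e; last by rewrite leNgt gtrBl e0.
apply: ge_sup supE.1 _ => _ [v v1 ->].
by have := leB v; rewrite formB v1; lra.
Qed.

Lemma gram_form A v : dot v (A^T *m A *m v) = dot (A *m v) (A *m v).
Proof. by rewrite -mulmxA dot_trmx trmxK. Qed.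

Lemma largest_singular_valueP A : (0 < m)%N ->
  0 <= largest_singular_value A /\
  forall v, euclidean_norm (A *m v) <= largest_singular_value A * euclidean_norm v.
Proof.
move=> m0.
have [|c eig_c le_c] := @rayleigh_sup_eigenvalue (A^T *m A) m0.
  by rewrite trmx_mul trmxK.
have eig_le a : eigenvalue (A^T *m A) a -> 0 <= a <= c.
  case/eigenvalueP => v vA v0.
  (* Symmetry of the Gram matrix turns the row eigenvector into a column one, at which the form
     equals [a] times the squared norm. *)
  have eqv : A^T *m A *m v^T = a *: v^T.
    by apply: trmx_inj; rewrite !trmx_mul !trmxK vA linearZ /= trmxK.
  have vT0 : 0 < dot v^T v^T by rewrite dot_gt0 // trmx_eq0.
  rewrite -(pmulr_lge0 _ vT0) -(ler_pM2r vT0 a) -dotZr -eqv le_c andbT.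
  by rewrite gram_form dot_ge0.
have /andP[c0 _] := eig_le c eig_c.
have -> : largest_singular_value A = Num.sqrt c.
  apply/eqP; rewrite eq_le; apply/andP.
  (* [Num.sqrt c] is both a member and an upper bound of the set, hence its supremum. *)
  have sc : singular_value A (Num.sqrt c) by split; rewrite ?sqrtr_ge0 // sqr_sqrtr.
  have ub : ubound (singular_value A) (Num.sqrt c).
    move=> s [s0 /eig_le/andP[_ s2c]].
    by rewrite -(ger0_norm s0) -sqrtr_sqr ler_wsqrtr.
  split; first by apply: ge_sup ub; exists (Num.sqrt c).
  by apply: ub_le_sup sc; exists (Num.sqrt c).
split=> [|v]; first exact: sqrtr_ge0.
by rewrite !euclidean_normE -sqrtrM // ler_wsqrtr // -gram_form le_c.
Qed.

End Dot.

Lemma virtual_dynamics_bound (R : realType) (n m : nat) (A : nat -> 'I_n -> 'M[R]_m)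
    (lambda : R) (dx : nat -> 'cV[R]_m) (K : R) :
    (0 < m)%N -> 0 < lambda ->
    (forall i, \sum_(k < n) largest_singular_value (A i k) * lambda ^+ k
      <= lambda ^+ n) ->
    virtual_dynamics A dx -> 0 < K ->
    (forall j, (j < n)%N -> euclidean_norm (dx j) <= K * lambda ^+ j) ->
  forall i, euclidean_norm (dx i) <= K * lambda ^+ i.
Proof.
move=> m0 l0 gain dyn K0 init; elim/ltn_ind => i IH.
have [/init//|le_ni] := ltnP i n.
(* The recurrence is used at step [i - n]; the factor [K * lambda ^+ (i - n)] is common to all
   terms, and the gain condition absorbs the rest. *)
rewrite -(subnK le_ni) dyn; apply: le_trans (euclidean_norm_sum _ _) _.
apply: (@le_trans _ _ (K * lambda ^+ (i - n) *
    \sum_(k < n) largest_singular_value (A (i - n)%N k) * lambda ^+ k)); last first.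
  by rewrite exprD mulrA ler_pM2l ?mulr_gt0 ?exprn_gt0.
rewrite mulr_sumr; apply: ler_sum => k _.
have [s0 le_s] := largest_singular_valueP (A (i - n)%N k) m0.
apply: le_trans (le_s _) _.
rewrite mulrCA ler_wpM2l // -mulrA -exprD IH //.
by rewrite -[ltnRHS](subnK le_ni) ltn_add2l.
Qed.

Theorem theorem2 (R : realType) (n m : nat) (n_ge1 : (1 <= n)%N)
    (m_ge1 : (1 <= m)%N) (A : nat -> 'I_n -> 'M[R]_m)
    (lambda : R) (lambda_gt0 : 0 < lambda)
    (gain : forall i : nat,
      lambda ^+ n >=
        \sum_(k < n) largest_singular_value (A i k) * lambda ^+ k) :
  (forall (dx : nat -> 'cV[R]_m) (K : R),
     virtual_dynamics A dx ->
     0 < K ->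
     (forall j : nat, (j < n)%N -> euclidean_norm (dx j) <= K * lambda ^+ j) ->
     forall i : nat, euclidean_norm (dx (i + n)%N) <= K * lambda ^+ (i + n)) /\
  (lambda < 1 -> contracting_at_rate lambda A).
Proof.
split=> [dx K dyn K0 init i|lambda_lt1 dx dyn].
  exact: virtual_dynamics_bound init _.
(* Each quotient is at most the whole sum, so this [K] fits all initial displacements at once; the 1
   ensures positivity. *)
pose K := 1 + \sum_(j < n) euclidean_norm (dx j) / lambda ^+ j.
have term_ge0 (j : 'I_n) : 0 <= euclidean_norm (dx j) / lambda ^+ j.
  by rewrite divr_ge0 ?euclidean_norm_ge0 // exprn_ge0 ?ltW.
have K0 : 0 < K by rewrite ltr_pwDl // sumr_ge0.
have bound : forall i, euclidean_norm (dx i) <= K * lambda ^+ i.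
  apply: virtual_dynamics_bound dyn K0 _ => // j lt_jn.
  rewrite -ler_pdivrMr ?exprn_gt0 // /K (bigD1 (Ordinal lt_jn)) //=.
  by rewrite addrCA lerDl addr_ge0 // sumr_ge0.
split; last by exists K.
(* The norms are squeezed between 0 and a geometric sequence, which vanishes in the limit as
   [lambda < 1]. *)
apply: (@squeeze_cvgr _ _ _ _ (fun=> 0) (geometric K lambda)).
- by apply: nearW => i; rewrite euclidean_norm_ge0 bound.
- exact: cvg_cst.
- by apply: cvg_geometric; rewrite gtr0_norm.
Qed.
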